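(* Let $1\le p<q<\infty$, and let $Y$ be a Banach space with property $\mathrm{HFC}_q$. If $f:S_{\ell_p}\to Y$ is a uniform embedding, then there exists a constant $K>0$ such that $$\omega_f(\varepsilon)\ge K\varepsilon^{p/q}\qquad\text{for every } 0\le\varepsilon\le 2.$$
   Context: Banach spaces are over the real scalars. $S_X$ denotes the unit sphere of a Banach space $X$ with the metric $d(x,y)=\|x-y\|_X$. For a map $f:(\mathcal M,d_{\mathcal M})\to(\mathcal N,d_{\mathcal N})$ between metric spaces, let $\omega_f(t)=\sup\{d_{\mathcal N}(f(x),f(y)): d_{\mathcal M}(x,y)\le t\}$ and $\rho_f(t)=\inf\{d_{\mathcal N}(f(x),f(y)): d_{\mathcal M}(x,y)\ge t\}$ (with $\sup\emptyset=0$, $\inf\emptyset=+\infty$). $f$ is uniformly continuous if $\lim_{t\to0^+}\omega_f(t)=0$, and is a uniform embedding if moreover $\rho_f(t)>0$ for every $t>0$. $\mathrm{Lip}(f)=\sup_{x\ne y} d_{\mathcal N}(f(x),f(y))/d_{\mathcal M}(x,y)$. For an infinite set $\mathbb M\subseteq\mathbb N$ and $k\in\mathbb N$, let $[\mathbb M]^k=\{\overline n=(n_1,\dots,n_k)\in\mathbb M^k: n_1<\dots<n_k\}$, equipped with the Hamming distance $d_{\mathbf H}(\overline n,\overline m)=|\{j:n_j\ne m_j\}|$. For $q\in(1,\infty]$ and $\lambda>0$, a metric space $\mathcal M$ has property $\lambda$-$\mathrm{HFC}_q$ if for every $k\in\mathbb N$ and every Lipschitz function $g:([\mathbb N]^k,d_{\mathbf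 H})\to\mathcal M$ there is an infinite $\mathbb M\subseteq\mathbb N$ such that $d_{\mathcal M}(g(\overline n),g(\overline m))\le\lambda k^{1/q}\,\mathrm{Lip}(g)$ for all $\overline n,\overline m\in[\mathbb M]^k$. $\mathcal M$ has property $\mathrm{HFC}_q$ if it has property $\lambda$-$\mathrm{HFC}_q$ for some $\lambda>0$. *)

(* Defs.v *)
From HB Require Import structures.
From mathcomp Require Import all_boot all_order all_algebra.
From mathcomp Require Import all_classical all_reals all_analysis.

Set Implicit Arguments.
Unset Strict Implicit.
Unset Printing Implicit Defensive.

Import Order.TTheory GRing.Theory Num.Theory.
Import numFieldNormedType.Exports.

Local Open Scope classical_set_scope.
Local Open Scope ring_scope.

(* [set_type A] already carries the induced pseudometric. *)
Section subset_metric.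
Context {R : realType} {X : metricType R} (A : set X).

Let dist (x y : A) : R := mdist (set_val x) (set_val y).

Let dist_ge0 x y : 0 <= dist x y. Proof. exact: mdist_ge0. Qed.

Let dist_positivity x y : dist x y = 0 -> x = y.
Proof. by move=> /mdist_positivity xy; exact: val_inj. Qed.

Let ballE (x : A) d : ball x d = [set y | dist x y < d].
Proof.
by rewrite -initial_ballE ballEmdist.
Qed.

HB.instance Definition _ :=
  @PseudoMetric_isMetric.Build R (A : Type) dist dist_ge0 dist_positivity ballE.

End subset_metric.

(* A normed module is not canonically a [metricType] in the library; this
   alias of [V] adds the distance `|x - y| to the existing structure. *)
Definition norm_metric {R : realType} (V : normedModType R) : Type := V.

Section norm_metric.
Context {R : realType} (V : normedModType R).

HB.instance Definition _ := NormedModule.copy (norm_metric V) V.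

Let dist (x y : norm_metric V) : R := `|x - y|.

Let dist_ge0 x y : 0 <= dist x y. Proof. exact: normr_ge0. Qed.

Let dist_positivity x y : dist x y = 0 -> x = y.
Proof. by move/normr0_eq0/eqP; rewrite subr_eq0 => /eqP. Qed.

Let ballE (x : norm_metric V) d : ball x d = [set y | dist x y < d].
Proof. by rewrite -ball_normE. Qed.

HB.instance Definition _ := @PseudoMetric_isMetric.Build R (norm_metric V)
  dist dist_ge0 dist_positivity ballE.

End norm_metric.

Definition unit_sphere {R : realType} (V : normedModType R) :
    set (norm_metric V) :=
  [set x | `|x| = 1].
Arguments unit_sphere {R} V.

(* Functions on nat are all measurable and only the empty set is
   [counting]-negligible, so no quotient is needed: these are exactly the real
   sequences x with \sum_k |x_k|^p finite, and the norm is its p-th root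
   (see [Lnorm_counting]). *)
Definition ell {R : realType} (p : R) (p1 : (1 <= p%:E)%E) : Type :=
  LfunType (@counting nat R) p1.

Section ell.
Context {R : realType} (p : R) (p1 : (1 <= p%:E)%E).

HB.instance Definition _ := GRing.Lmodule.copy (ell p1)
  (LfunType (@counting nat R) p1).

Definition ell_norm (x : ell p1) : R :=
  fine ('N[@counting nat R]_(p%:E) [EFin \o (x : nat -> R)])%E.

Let ell_normD (x y : ell p1) : ell_norm (x + y) <= ell_norm x + ell_norm y.
Proof. exact: ler_LnormD. Qed.

Let ell_normZ (a : R) (x : ell p1) : ell_norm (a *: x) = `|a| * ell_norm x.
Proof.
apply: EFin_inj; rewrite EFinM /ell_norm !finite_norm_fine.
exact: LnormZ.
Qed.

Let ell_norm_eq0 (x : ell p1) : ell_norm x = 0 -> x = 0.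
Proof.
move=> /fine_Lnormr_eq0[N [_ N0 sub]]; apply/LfuneqP => n.
apply: contrapT => xn.
have Nn : N n by apply: sub => /=; move=> /(_ I).
move: N0; rewrite /= /counting; case: ifPn => [/asboolP finN /eqP|//].
rewrite eqe pnatr_eq0 finmap.cardfs_eq0 => /eqP N0.
by have := mem_set Nn; rewrite -in_fset_set// N0 finmap.in_fset0.
Qed.

HB.instance Definition _ :=
  Lmodule_isNormed.Build R (ell p1) ell_normD ell_normZ ell_norm_eq0.

End ell.

(* [R] only serves to fix the field in which the Hamming distance lives. *)
Definition hamming (R : realType) (k : nat) : Type :=
  {n : k.-tuple nat | sorted ltn n}.

Section hamming.
Context {R : realType} {k : nat}.
Implicit Types n m : hamming R k.

HB.instance Definition _ := Choice.copy (hamming R k)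
  {n : k.-tuple nat | sorted ltn n}.

Definition hamming_dist n m : R :=
  #|[pred j : 'I_k | tnth (val n) j != tnth (val m) j]|%:R.

Let hamming_distxx n : hamming_dist n n = 0.
Proof. by rewrite /hamming_dist eq_card0// => j; rewrite !inE eqxx. Qed.

Let hamming_dist_positivity n m : hamming_dist n m = 0 -> n = m.
Proof.
move=> /eqP; rewrite pnatr_eq0 => /eqP/card0_eq nm.
apply/val_inj/eq_from_tnth => j; apply/eqP.
by have := nm j; rewrite !inE => /negbFE.
Qed.

Let hamming_dist_sym n m : hamming_dist n m = hamming_dist m n.
Proof.
by congr (_%:R); apply: eq_card => j; rewrite !inE eq_sym.
Qed.

Let hamming_dist_triangle m n l :
  hamming_dist n l <= hamming_dist n m + hamming_dist m l.
Proof.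
rewrite -natrD ler_nat -cardUI (leq_trans _ (leq_addr _ _))//.
apply/subset_leq_card/fintype.subsetP => j; rewrite !inE.
by apply: contraNT; rewrite negb_or !negbK => /andP[/eqP-> /eqP->].
Qed.

HB.instance Definition _ := isMetric.Build R (hamming R k)
  hamming_distxx hamming_dist_positivity hamming_dist_sym hamming_dist_triangle.

(* [M]^k inside [N]^k *)
Definition tuples_in (M : set nat) : set (hamming R k) :=
  [set n | forall j, M (tnth (val n) j)].

End hamming.

Section metric_maps.
Context {R : realType}.
Implicit Types M N : metricType R.

(* All values are nonnegative: adding 0 implements sup set0 = 0 (the library
   has ereal_sup set0 = -oo). *)
Definition omega M N (f : M -> N) (t : R) : \bar R :=
  ereal_sup ([set 0%E] `|`
    [set e | exists x y, mdist x y <= t /\ e = (mdist (f x) (f y))%:E]).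

Definition rho M N (f : M -> N) (t : R) : \bar R :=
  ereal_inf [set e | exists x y, t <= mdist x y /\ e = (mdist (f x) (f y))%:E].

Definition uniformly_continuous M N (f : M -> N) : Prop :=
  omega f t @[t --> 0^'+] --> 0%E.

Definition uniform_embedding M N (f : M -> N) : Prop :=
  uniformly_continuous f /\ forall t, 0 < t -> (0 < rho f t)%E.

Definition Lip M N (f : M -> N) : \bar R :=
  ereal_sup ([set 0%E] `|`
    [set e | exists x y, x <> y /\ e = (mdist (f x) (f y) / mdist x y)%:E]).

(* The exponent is 1/q, with 1/+oo = 0. *)
Definition lambda_HFC (lambda : R) (q : \bar R) M : Prop :=
  forall (k : nat) (g : hamming R k -> M), (Lip g < +oo)%E ->
  exists2 A : set nat, infinite_set A &
    forall n m, tuples_in A n -> tuples_in A m ->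
      ((mdist (g n) (g m))%:E <=
         (lambda * k%:R `^ fine (q^-1)%E)%:E * Lip g)%E.

Definition HFC (q : \bar R) M : Prop :=
  exists2 lambda : R, 0 < lambda & lambda_HFC lambda q M.

End metric_maps.

(* Main.v *)
Require Import Defs.
From mathcomp Require Import all_boot all_order all_algebra.
From mathcomp Require Import all_classical all_reals all_analysis.

Import Order.TTheory GRing.Theory Num.Theory.
Import numFieldNormedType.Exports.

Local Open Scope classical_set_scope.
Local Open Scope ring_scope.

(** The key inequality rho_le_omega compares the modulus of continuity of a map
    on the unit sphere of l_p at a small scale with its compression modulus at
    one fixed scale, through Hamming cubes inside the sphere.

    For k > 0, let each k-tuple n of natural numbers (not necessarily sorted) be
    sent to the vector x_n with exactly k nonzero entries, all equal to
    k^(-1/p), whose j-th nonzero position encodes the pair (j, n_j). Then x_n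
    has norm 1, and if n and m differ in d coordinates then
    |x_n - x_m| = (2 d / k)^(1/p) (sphere_hamming_model). Hence, with
    W = omega_f ((2/k)^(1/p)), assumed finite since nothing is to be proved
    otherwise, changing one coordinate of n moves f (x_n) by at
    most W, and changing the coordinates one at a time shows that n |-> f (x_n)
    is W-Lipschitz for the Hamming distance (mdist_le_diff_count). Unsorted
    tuples are useful here: the intermediate tuples need not be increasing.

    The concentration property now gives an infinite set A of integers such
    that f (x_n) and f (x_m) are within lambda k^(1/q) W for increasing tuples
    n and m in A. Such tuples can be chosen with no common coordinate, so that
    x_n and x_m are at distance 2^(1/p) whatever k is; therefore
      rho_f (2^(1/p)) <= lambda k^(1/q) omega_f ((2/k)^(1/p)).

    The left-hand side is a positive constant. For 0 < eps <= 2, take k to be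
    the least integer above 2 / eps^p: then (2/k)^(1/p) <= eps, while k is at
    most a constant multiple of eps^(-p), so that k^(1/q) is at most a constant
    multiple of eps^(-p/q); this is the lower bound on omega_f eps. *)

(** * Finitely supported sequences in l_p *)

Lemma Lnorm_counting_finite_support {R : realType} {p : R} (f : nat -> R)
    (N : nat) : 0 < p -> (forall i, (N <= i)%N -> f i = 0) ->
  ('N[@counting nat R]_(p%:E) [EFin \o f])%E =
    ((\sum_(0 <= i < N) `|f i| `^ p) `^ p^-1)%:E.
Proof.
move=> p0 f0; rewrite Lnorm_counting// (nneseries_split 0 N); last first.
  by move=> k _; exact: poweR_ge0.
rewrite add0n eseries0 ?adde0; last first.
  by move=> i Ni _ /=; rewrite f0// normr0 powR0// gt_eqF.
by rewrite sumEFin poweR_EFin.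
Qed.

Lemma ell_normE {R : realType} (p : R) (p1 : (1 <= p%:E)%E) (x : ell p1)
    (N : nat) : (forall i, (N <= i)%N -> (x : nat -> R) i = 0) ->
  `|x| = (\sum_(0 <= i < N) `|(x : nat -> R) i| `^ p) `^ p^-1.
Proof.
move=> x0; have p0 : 0 < p by rewrite (lt_le_trans ltr01).
by rewrite -[LHS]/(ell_norm x) /ell_norm
  (Lnorm_counting_finite_support _ N p0 x0).
Qed.

Lemma finite_support_ell {R : realType} {p : R} (p1 : (1 <= p%:E)%E)
    (f : nat -> R) (N : nat) : (forall i, (N <= i)%N -> f i = 0) ->
  exists x : ell p1, (x : nat -> R) =1 f.
Proof.
move=> f0; have p0 : 0 < p by rewrite (lt_le_trans ltr01).
have fL : f \in Lfun (@counting nat R) p%:E.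
  rewrite inE; apply/andP; split; rewrite inE//=.
  by rewrite /finite_norm (Lnorm_counting_finite_support _ N p0 f0) ltry.
by exists (Lfun_Sub p1 fL).
Qed.

(** * Hamming cubes in the unit sphere *)

Lemma sum_nat_divmod {R : realType} (k L : nat) (F : nat -> nat -> R) :
  \sum_(0 <= i < L * k) F (i %% k)%N (i %/ k)%N =
    \sum_(j < k) \sum_(0 <= l < L) F j l.
Proof.
case: k => [|k]; first by rewrite muln0 big_nil big_ord0.
rewrite big_nat_mul exchange_big/=; apply: eq_bigr => l _.
rewrite -{1}[(l * _)%N]add0n big_addn mulSn addnK big_mkord.
apply: eq_bigr => j _.
by rewrite addnC modnMDl modn_small// divnMDl// divn_small ?addn0.
Qed.

Definition diff_count {k : nat} (n m : k.-tuple nat) : nat :=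
  #|[pred j | tnth n j != tnth m j]|.

(** The indices of a sequence are read as pairs by Euclidean division by k: the
    indices congruent to j form the j-th column, and the tuple n puts the value
    c at height n_j of the column j. Since each coordinate has its own column,
    every tuple marks exactly k positions, even when it is unsorted or has
    repetitions. *)
Definition block_vector {R : realType} {k : nat} (c : R) (n : k.-tuple nat)
    (i : nat) : R := c *+ (nth 0%N n (i %% k) == (i %/ k)%N).

Lemma block_vector_support {R : realType} {k : nat} (c : R)
    (n : k.-tuple nat) (L : nat) : (0 < k)%N -> (forall j, tnth n j < L)%N ->
  forall i, (L * k <= i)%N -> block_vector c n i = 0.
Proof.
move=> k0 nL i Li; rewrite /block_vector.
have := nL (Ordinal (ltn_pmod i k0)); rewrite (tnth_nth 0%N)/= => nLi.
by rewrite ltn_eqF// (leq_trans nLi)// leq_divRL.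
Qed.

Lemma tuple_bounded (k : nat) (n : k.-tuple nat) :
  exists L, forall j, (tnth n j < L)%N.
Proof.
by exists (\max_j tnth n j).+1 => j; rewrite ltnS; exact: leq_bigmax.
Qed.

Lemma sum_delta {R : realType} (c : R) {a L : nat} : (a < L)%N ->
  \sum_(0 <= l < L) c *+ (a == l) = c.
Proof.
move=> aL; rewrite big_mkord (bigD1 (Ordinal aL))//= eqxx big1 ?addr0// => l.
by rewrite -val_eqE/= eq_sym => /negbTE->.
Qed.

Lemma sum_block_vector {R : realType} {k : nat} (p c : R) (n : k.-tuple nat)
    (L : nat) : 0 < p -> 0 <= c -> (forall j, tnth n j < L)%N ->
  \sum_(0 <= i < L * k) `|block_vector c n i| `^ p = k%:R * c `^ p.
Proof.
move=> p0 c0 nL.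
rewrite (@sum_nat_divmod _ k L (fun j l => `|c *+ (nth 0%N n j == l)| `^ p)).
rewrite (eq_bigr (fun=> c `^ p)) ?sumr_const ?card_ord ?mulr_natl// => j _.
rewrite -[RHS](sum_delta (c `^ p) (nL j)); apply: eq_bigr => l _.
rewrite (tnth_nth 0%N); case: eqP => _; first by rewrite ger0_norm.
by rewrite normr0 powR0// gt_eqF.
Qed.

(** In a column where n and m agree the entries cancel; in any other column the
    two entries c have distinct heights and each contributes c^p. *)
Lemma sum_block_vectorB {R : realType} {k : nat} (p c : R)
    (n m : k.-tuple nat) (L : nat) : 0 < p -> 0 <= c ->
  (forall j, tnth n j < L)%N -> (forall j, tnth m j < L)%N ->
  \sum_(0 <= i < L * k) `|block_vector c n i - block_vector c m i| `^ p =
  (2 * diff_count n m)%:R * c `^ p.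
Proof.
move=> p0 c0 nL mL.
rewrite (@sum_nat_divmod _ k L (fun j l =>
  `|c *+ (nth 0%N n j == l) - c *+ (nth 0%N m j == l)| `^ p)).
rewrite natrM mulrAC [RHS]mulr_natr -sumr_const [RHS]big_mkcond/=.
apply: eq_bigr => j _; rewrite inE; case: ifPn => [|/negbNE/eqP nm]; last first.
  by apply: big1 => l _; rewrite -!tnth_nth nm subrr normr0 powR0// gt_eqF.
move=> nm; rewrite mulr_natl mulr2n.
have -> : c `^ p + c `^ p = \sum_(0 <= l < L) (c `^ p *+ (tnth n j == l) +
    c `^ p *+ (tnth m j == l)) by rewrite big_split/= !sum_delta.
apply: eq_bigr => l _.
rewrite -!tnth_nth; case: eqP => [nl|_]; case: eqP => [ml|_].
- by move: nm; rewrite nl ml eqxx.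
- by rewrite subr0 ger0_norm// addr0.
- by rewrite sub0r normrN ger0_norm// add0r.
- by rewrite subrr normr0 powR0 ?gt_eqF// addr0.
Qed.

(** The scaling c = k^(-1/p) normalizes the block vectors, which have k nonzero
    entries. The exponent 1/p makes the embedding a snowflake of the normalized
    Hamming distance: neighbours are at distance (2/k)^(1/p), while tuples with
    no common coordinate are at distance 2^(1/p) independently of k. *)
Lemma sphere_hamming_model {R : realType} {p : R} (p1 : (1 <= p%:E)%E)
    (k : nat) : (0 < k)%N ->
  exists x : k.-tuple nat -> unit_sphere (ell p1), forall n m,
    mdist (x n) (x m) =
      ((2 * diff_count n m)%:R / k%:R) `^ p^-1.
Proof.
move=> k0; have p0 : 0 < p by rewrite (lt_le_trans ltr01).
have kR : 0 < k%:R :> R by rewrite ltr0n.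
pose c : R := k%:R `^ (- p^-1).
have c0 : 0 <= c by exact: powR_ge0.
have cp : c `^ p = k%:R^-1.
  by rewrite -powRrM mulNr mulVf ?gt_eqF// powR_inv1// ltW.
have /choice[v vE] : forall n : k.-tuple nat,
    exists x : ell p1, (x : nat -> R) =1 block_vector c n.
  move=> n; have [L nL] := tuple_bounded _ n.
  exact: finite_support_ell (block_vector_support c n L k0 nL).
have vS n : v n \in unit_sphere (ell p1).
  apply/mem_set; change (`|v n : ell p1| = 1); have [L nL] := tuple_bounded _ n.
  rewrite (@ell_normE _ _ _ _ (L * k)); last first.
    by move=> i; rewrite vE; exact: block_vector_support.
  under eq_bigr do rewrite vE.
  by rewrite sum_block_vector// cp divff ?gt_eqF// powR1.
exists (fun n => SigSub (vS n)) => n m.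
rewrite -[LHS]/(`|v n - v m|).
have [L1 nL1] := tuple_bounded _ n; have [L2 nL2] := tuple_bounded _ m.
pose L := (L1 + L2)%N.
have nL j : (tnth n j < L)%N by rewrite (leq_trans (nL1 j))// leq_addr.
have mL j : (tnth m j < L)%N by rewrite (leq_trans (nL2 j))// leq_addl.
rewrite (@ell_normE _ _ _ _ (L * k)); last first.
  move=> i Li; rewrite -[LHS]/((v n : nat -> R) i - (v m : nat -> R) i) !vE.
  by rewrite !(block_vector_support _ _ L)// subrr.
under eq_bigr => i _.
  rewrite -[X in `|X|]/((v n : nat -> R) i - (v m : nat -> R) i) !vE; over.
by rewrite sum_block_vectorB// cp.
Qed.

(** All tuples, sorted or not, are vertices of the Hamming graph, whose path
    distance is the number of differing coordinates: any differing coordinate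
    of n may be replaced by that of m, and the triangle inequality adds up the
    steps. *)
Lemma mdist_le_diff_count {R : realType} {N : metricType R} {k : nat}
    (h : k.-tuple nat -> N) (W : R) :
  (forall n m, (diff_count n m <= 1)%N -> mdist (h n) (h m) <= W) ->
  forall n m, mdist (h n) (h m) <= W * (diff_count n m)%:R.
Proof.
move=> hW n m; move dE : (diff_count n m) => d.
elim: d n dE => [|d IHd] n dE.
  have -> : n = m.
    apply: eq_from_tnth => j; apply/eqP.
    by have := card0_eq dE j; rewrite !inE => /negbFE.
  by rewrite mdistxx mulr0.
have /card_gt0P[j] : (0 < diff_count n m)%N by rewrite dE.
rewrite inE => nmj.
pose n' := [tuple if i == j then tnth m i else tnth n i | i < k].
have n'j i : tnth n' i = if i == j then tnth m i else tnth n i.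
  by rewrite tnth_mktuple.
have dn' : diff_count n' m = d.
  apply: succn_inj; rewrite -dE /diff_count (cardD1 j [pred i | tnth n i != _]).
  rewrite inE nmj add1n; congr _.+1; apply: eq_card => i.
  by rewrite !inE n'j; case: (i == j); rewrite ?eqxx.
rewrite (le_trans (metric_triangle _ (h n') _))// -natr1 mulrDr mulr1 addrC.
rewrite lerD ?IHd// hW// -(card1 j); apply/subset_leq_card/fintype.subsetP => i.
by rewrite !inE n'j; case: (i == j); rewrite ?eqxx.
Qed.

(** * Increasing tuples in an infinite set *)

Lemma infinite_nat_unbounded (A : set nat) (b : nat) : infinite_set A ->
  exists2 a, A a & (b < a)%N.
Proof.
move=> Ainf; apply: contrapT => /forall2NP Ab; apply: Ainf.
apply: (@sub_finite_set _ _ `I_b.+1); last exact: finite_II.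
by move=> a Aa /=; have [//|/negP] := Ab a; rewrite -leqNgt ltnS.
Qed.

Lemma infinite_nat_increasing (A : set nat) (b k : nat) : infinite_set A ->
  exists s : k.-tuple nat, path ltn b s /\ forall j, A (tnth s j).
Proof.
move=> Ainf; elim: k b => [|k IHk] b.
  by exists [tuple]; split=> // -[].
have [a Aa ba] := infinite_nat_unbounded _ b Ainf.
have [s [sp sA]] := IHk a; exists [tuple of a :: s]; split=> /=.
  by rewrite ba.
by move=> j; case: (unliftP ord0 j) => [i|] ->; rewrite ?tnthS ?tnth0.
Qed.

(** The second tuple is taken above all the entries of the first one. *)
Lemma tuples_in_disjoint (R : realType) (k : nat) (A : set nat) :
  infinite_set A ->
  exists n m : hamming R k, [/\ tuples_in A n, tuples_in A m &
    diff_count (val n) (val m) = k].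
Proof.
move=> Ainf.
have [s [sp sA]] := infinite_nat_increasing _ 0 k Ainf.
have [L sL] := tuple_bounded _ s.
have [u [up uA]] := infinite_nat_increasing _ L k Ainf.
exists (exist _ s (path_sorted sp)), (exist _ u (path_sorted up)).
split=> //=; rewrite -[RHS]card_ord; apply: eq_card => j; rewrite !inE.
rewrite ltn_eqF// (ltn_trans (sL j))//.
by have /allP := order_path_min ltn_trans up; apply; exact: mem_tnth.
Qed.

(** * Moduli of maps between metric spaces *)

Lemma omega_ge0 {R : realType} {M N : metricType R} (f : M -> N) (t : R) :
  (0 <= omega f t)%E.
Proof. by apply: ereal_sup_ubound; left. Qed.

Lemma omega_ge {R : realType} {M N : metricType R} (f : M -> N) (t : R) x y :
  mdist x y <= t -> ((mdist (f x) (f y))%:E <= omega f t)%E.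
Proof. by move=> xy; apply: ereal_sup_ubound; right; exists x, y. Qed.

Lemma le_omega {R : realType} {M N : metricType R} (f : M -> N) (s t : R) :
  s <= t -> (omega f s <= omega f t)%E.
Proof.
move=> st; apply: ge_ereal_sup => _ [->|[x [y [xy ->]]]].
  exact: omega_ge0.
by apply: omega_ge; exact: le_trans st.
Qed.

Lemma Lip_le {R : realType} {M N : metricType R} (f : M -> N) (W : R) :
  0 <= W -> (forall x y, mdist (f x) (f y) <= W * mdist x y) ->
  (Lip f <= W%:E)%E.
Proof.
move=> W0 fW; apply: ge_ereal_sup => _ [->|[x [y [/eqP xy ->]]]].
  by rewrite lee_fin.
by rewrite lee_fin ler_pdivrMr ?mdist_gt0.
Qed.

(** * Compression against expansion *)

(** Concentration is applied to the restriction of n |-> f (x_n) to increasing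
    tuples; two increasing tuples with no common coordinate realize the distance
    2^(1/p), and their images bound the compression modulus from above. *)
Lemma rho_le_omega {R : realType} {p q lambda : R} (p1 : (1 <= p%:E)%E)
    (N : metricType R) (f : unit_sphere (ell p1) -> N) (k : nat) :
  0 < q -> 0 < lambda -> lambda_HFC lambda q%:E N -> (0 < k)%N ->
  (rho f (2 `^ p^-1) <=
     (lambda * k%:R `^ q^-1)%:E * omega f ((2 / k%:R) `^ p^-1))%E.
Proof.
move=> q0 l0 Nq k0; have p0 : 0 < p by rewrite (lt_le_trans ltr01).
have kR : 0 < k%:R :> R by rewrite ltr0n.
have lk : 0 < lambda * k%:R `^ q^-1 by rewrite mulr_gt0// powR_gt0.
have [x xE] := sphere_hamming_model p1 k k0.
case WE : (omega f _) => [W| |]; last 2 first.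
- by rewrite gt0_muley// leey.
- by have := omega_ge0 f ((2 / k%:R) `^ p^-1); rewrite WE.
have W0 : 0 <= W by rewrite -lee_fin -WE omega_ge0.
pose g (n : hamming R k) := f (x (val n)).
have gW : (Lip g <= W%:E)%E.
  apply: Lip_le => // n m; apply: (mdist_le_diff_count (f \o x)) => {}n {}m nm.
  rewrite -lee_fin -WE omega_ge// xE ge0_ler_powR ?nnegrE ?invr_ge0 ?(ltW p0)//.
  by rewrite ler_pM2r ?invr_gt0// ler_nat -[leqRHS]muln1 leq_mul2l.
have [|A Ainf gA] := Nq k g; first by rewrite (le_lt_trans gW)// ltry.
have [n [m [An Am nm]]] := tuples_in_disjoint R k A Ainf.
have xnm : mdist (x (val n)) (x (val m)) = 2 `^ p^-1.
  by rewrite xE nm natrM mulfK// gt_eqF.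
have rho_le : (rho f (2 `^ p^-1) <= (mdist (g n) (g m))%:E)%E.
  by apply: ereal_inf_lbound; exists (x (val n)), (x (val m)); rewrite xnm.
rewrite (le_trans rho_le)// (le_trans (gA n m An Am))//.
rewrite inver gt_eqF//= lee_pmul2l//.
Qed.

Theorem theorem3p2 (R : realType) (p q : R) (p1 : (1 <= p%:E)%E) (pq : p < q)
    (Y : completeNormedModType R) (YHFC : HFC q%:E (norm_metric Y))
    (f : unit_sphere (ell p1) -> norm_metric Y) (fe : uniform_embedding f) :
  exists K : R, 0 < K /\
    forall eps : R, 0 <= eps <= 2 ->
      ((K * eps `^ (p / q))%:E <= omega f eps)%E.
Proof.
have p0 : 0 < p by rewrite (lt_le_trans ltr01).
have q0 : 0 < q by rewrite (lt_trans p0).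
have [lambda l0 Yq] := YHFC.
have [r r0 rf] : exists2 r : R, 0 < r & (r%:E <= rho f (2 `^ p^-1))%E.
  have : (0 < rho f (2 `^ p^-1))%E by apply: (proj2 fe); rewrite powR_gt0.
  case: (rho _ _) => [s| |]// s0; [by exists s|by exists 1 => //; rewrite leey].
(* As eps <= 2, one has 2 / eps^p + 1 <= (2 + 2^p) / eps^p, which bounds the
   integer k below. *)
pose C : R := 2 + 2 `^ p.
have C0 : 0 < C by rewrite addr_gt0// powR_gt0.
pose B := lambda * C `^ q^-1.
have B0 : 0 < B by rewrite mulr_gt0// powR_gt0.
exists (r / B); split=> [|eps /andP[]]; first by rewrite divr_gt0.
rewrite le_eqVlt => /orP[/eqP<- _|eps0 eps2].
  by rewrite powR0 ?mulr0 ?omega_ge0// gt_eqF// divr_gt0.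
have ep0 : 0 < eps `^ p by rewrite powR_gt0.
pose k := (Num.truncn (2 / eps `^ p)).+1.
have kR : 0 < k%:R :> R by rewrite ltr0n.
have k_ge : 2 / eps `^ p <= k%:R by apply/ltW/truncnS_gt.
have k_le : k%:R <= C / eps `^ p.
  rewrite /k -[leLHS]natr1 [leRHS]mulrDl lerD//.
    by rewrite truncn_le// divr_ge0// ltW.
  by rewrite ler_pdivlMr// mul1r ge0_ler_powR ?nnegrE// ltW.
have t_le : (2 / k%:R) `^ p^-1 <= eps.
  have -> : eps = (eps `^ p) `^ p^-1.
    by rewrite -powRrM divff ?gt_eqF// powRr1// ltW.
  rewrite ge0_ler_powR ?nnegrE ?invr_ge0 ?divr_ge0 ?powR_ge0 ?(ltW p0)//.
  by rewrite ler_pdivrMr// mulrC -ler_pdivrMr.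
have lk0 : (0 <= (lambda * k%:R `^ q^-1)%:E)%E.
  by rewrite lee_fin mulr_ge0 ?powR_ge0// ltW.
have := le_trans rf (rho_le_omega p1 _ f k q0 l0 Yq isT).
move=> /le_trans/(_ (lee_wpmul2l lk0 (le_omega f _ _ t_le))).
case: (omega f eps) (omega_ge0 f eps) => [W| |]//; last first.
  by move=> _ _; rewrite leey.
rewrite -EFinM !lee_fin => W0 rW.
rewrite mulrAC ler_pdivrMr// (le_trans (ler_wpM2r (powR_ge0 _ _) rW))//.
rewrite mulrAC mulrC ler_wpM2l// /B -mulrA ler_wpM2l ?(ltW l0)//.
rewrite powRrM -powRM ?powR_ge0//.
rewrite ge0_ler_powR ?nnegrE ?invr_ge0 ?mulr_ge0 ?powR_ge0
  ?(ltW q0) ?(ltW C0)//.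
by rewrite -ler_pdivlMr.
Qed.
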